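(* Let $P$ and $P'$ be $\pi$-calculus processes. 1. If $P\Rrightarrow^* P'$, then $\vdash_{\mathsf{PiL}} [\![P']\!]\multimap[\![P]\!]$. 2. If $P\to P'$, then either (a) the core-reduction of $P\to P'$ is a $\mathsf{Com}$ or a $\mathsf{Label}$, and $\vdash_{\mathsf{PiL}}[\![P']\!]\multimap[\![P]\!]$; or (b) the core-reduction of $P\to P'$ is a $\mathsf{Choice}$, and there is a set of processes $\{P_\ell\mid \ell\in L\}$ containing $P'$ such that $P\to P_\ell$ for all $\ell\in L$ and $\vdash_{\mathsf{PiL}}\big(\&_{\ell\in L}[\![P_\ell]\!]\big)\multimap[\![P]\!]$.
   Context: **Processes.** Fix a countable set of names and a finite set of labels, disjoint from names. Processes: $P,Q::=\mathsf{Nil}\mid x!\langle y\rangle.P\mid x?(y).P\mid P\,|\,Q\mid(\nu x)P\mid x\triangleleft\{\ell:P_\ell\}_{\ell\in L}\mid x\triangleright\{\ell:P_\ell\}_{\ell\in L}$, with $x,y$ names and $L$ a nonempty set of labels. $x?(y).P$ binds $y$ in $P$ and $(\nu x)P$ binds $x$ in $P$; free names, $\alpha$-equivalence and capture-avoiding substitution $P[x/y]$ ($x$ for $y$) are standard. Processes are assumed written unambiguously: each restricted name is bound by a unique $\nu$ and does not also occur free. **Structural precongruence.** $\Rrightarrow$ is the closure under process contexts of: $P|Q\Rrightarrow Q|P$; $(P|Q)|R\Rrightarrow P|(Q|R)$ and conversely; $(\nu x)(\nu y)P\Rrightarrow(\nu y)(\nu x)P$; $P|\mathsf{Nil}\Rrightarrow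 P$; and, if $x$ is not free in $S$, $(\nu x)S\Rrightarrow S$ and $(\nu x)P\,|\,S\Rrightarrow(\nu x)(P|S)$. $\Rrightarrow^*$ is its reflexive-transitive closure. **Reduction $\to$.** Generated by - $\mathsf{Com}$: $x!\langle a\rangle.P\,|\,x?(b).Q\to P\,|\,Q[a/b]$; - $\mathsf{Choice}$: $x\triangleleft\{\ell:P_\ell\}_{\ell\in L}\to x\triangleleft\{\ell_k:P_{\ell_k}\}$ if $\ell_k\in L$; - $\mathsf{Label}$: $x\triangleleft\{\ell_k:P_{\ell_k}\}\,|\,x\triangleright\{\ell:Q_\ell\}_{\ell\in L}\to P_{\ell_k}|Q_{\ell_k}$ if $\ell_k\in L$; - $\mathsf{Res}$: $(\nu x)P\to(\nu x)P'$ if $P\to P'$; $\mathsf{Par}$: $P|Q\to P'|Q$ if $P\to P'$; - $\mathsf{Struc}$: $P\to Q$ if $P\Rrightarrow^*P'\ne P$ and $P'\to Q$ is obtained without using $\mathsf{Struc}$. The *core-reduction* of a step $P\to P'$ is the instance of $\mathsf{Com}$, $\mathsf{Choice}$ or $\mathsf{Label}$ at the top of its derivation (ignoring $\mathsf{Par},\mathsf{Res},\mathsf{Struc}$). **Formulas of $\mathsf{PiL}$.** Let $\mathcal V$ be a countable set of variables containing all names. Formulas: $A,B ::= \circ \mid \langle x!t\rangle \mid (x?t) \mid A⅋B \mid A\otimes B\mid A\blacktriangleleft B\mid \bigoplus_{i\in I} A_i\mid \&_{i\in I} A_i\mid \forall x.A\mid\exists x.A\mid \mathsf{New}\,x.A\mid\mathsf{Ya}\,x.A$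 with $x\in\mathcal V$, $t$ a variable or a label (labels are constants, never quantified), $I$ finite nonempty. Formulas are modulo $\alpha$-equivalence; formulas and sequents are *clean*: each variable is bound by at most one universal quantifier or at most one pair of dual nominal quantifiers ($\mathsf{New}$/$\mathsf{Ya}$), and bound variables do not also occur free. Negation is involutive with $\circ^\bot=\circ$, $\langle x!t\rangle^\bot=(x?t)$, $(A⅋B)^\bot=A^\bot\otimes B^\bot$, $(A\blacktriangleleft B)^\bot=A^\bot\blacktriangleleft B^\bot$, $(\bigoplus_i A_i)^\bot=\&_i A_i^\bot$, $(\forall x.A)^\bot=\exists x.A^\bot$, $(\mathsf{New}\,x.A)^\bot=\mathsf{Ya}\,x.A^\bot$; and $A\multimap B:=A^\bot⅋B$. **Translation.** $[\![\mathsf{Nil}]\!]=\circ$, $[\![P|Q]\!]=[\![P]\!]⅋[\![Q]\!]$, $[\![(\nu x)P]\!]=\mathsf{New}\,x.[\![P]\!]$, $[\![x!\langle y\rangle.P]\!]=\langle x!y\rangle\blacktriangleleft[\![P]\!]$, $[\![x?(y).P]\!]=\exists y.((x?y)\blacktriangleleft[\![P]\!])$, $[\![x\triangleleft\{\ell:P_\ell\}_{\ell\in L}]\!]=\&_{\ell\in L}(\langle x!\ell\rangle\blacktriangleleft[\![P_\ell]\!])$, $[\![x\triangleright\{\ell:P_\ell\}_{\ell\in L}]\!]=\bigoplus_{\ell\in L}((x?\ell)\blacktriangleleft[\![P_\ell]\!])$. **Rules of $\mathsf{PiL}$.** Judgements are $\mathcal S\vdash\Gamma$ with $\Gamma$ a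 finite set of formula occurrences and $\mathcal S$ a store: a set of elements $x^{\mathsf{New}}$ or $x^{\mathsf{Ya}}$, each variable at most once; $\mathcal S_1,\mathcal S_2$ is a union without common variables. Rules (premises $\Rightarrow$ conclusion; $\dagger$: $x$ not free in $\Gamma$): - ax: $\Rightarrow \mathcal S\vdash\langle x!t\rangle,(x?t)$. Unit: $\Rightarrow\mathcal S\vdash\circ$. - $⅋$: $\mathcal S\vdash\Gamma,A,B\Rightarrow\mathcal S\vdash\Gamma,A⅋B$. $\otimes$: $\mathcal S_1\vdash\Gamma,A$ and $\mathcal S_2\vdash B,\Delta\Rightarrow\mathcal S_1,\mathcal S_2\vdash\Gamma,A\otimes B,\Delta$. mix: $\mathcal S_1\vdash\Gamma$ and $\mathcal S_2\vdash\Delta\Rightarrow\mathcal S_1,\mathcal S_2\vdash\Gamma,\Delta$. - $\oplus$: $\mathcal S\vdash\Gamma,A_k\Rightarrow\mathcal S\vdash\Gamma,\bigoplus_{i\in I}A_i$ ($k\in I$). $\&$: $\mathcal S\vdash\Gamma,A_i$ for all $i\in I$ $\Rightarrow\mathcal S\vdash\Gamma,\&_{i\in I}A_i$. - $\forall$: $\mathcal S\vdash\Gamma,A\Rightarrow\mathcal S\vdash\Gamma,\forall x.A$ ($\dagger$). $\exists$: $\mathcal S\vdash\Gamma,A[y/x]\Rightarrow\mathcal S\vdash\Gamma,\exists x.A$, $y\in\mathcal V$. - $\blacktriangleleft$: $\mathcal S_1\vdash\Gamma,A,C$ and $\mathcal S_2\vdash\Delta,B,D\Rightarrow\mathcal S_1,\mathcal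 S_2\vdash\Gamma,\Delta,A\blacktriangleleft B,C\blacktriangleleft D$. $\blacktriangleleft^\circ$: $\mathcal S_1\vdash\Gamma,A$ and $\mathcal S_2\vdash\Delta,B\Rightarrow\mathcal S_1,\mathcal S_2\vdash\Gamma,\Delta,A\blacktriangleleft B$. - $\mathsf{New}_\circ$: $\mathcal S\vdash\Gamma,A\Rightarrow\mathcal S\vdash\Gamma,\mathsf{New}\,x.A$ ($\dagger$). $\mathsf{New}_{load}$: $\mathcal S,x^{\mathsf{New}}\vdash\Gamma,A\Rightarrow\mathcal S\vdash\Gamma,\mathsf{New}\,x.A$ ($\dagger$). $\mathsf{New}_{pop}$: $\mathcal S\vdash\Gamma,A[y/x]\Rightarrow\mathcal S,y^{\mathsf{New}}\vdash\Gamma,\mathsf{Ya}\,x.A$. - $\mathsf{Ya}_\circ,\mathsf{Ya}_{load},\mathsf{Ya}_{pop}$: the same three rules with $\mathsf{New}$ and $\mathsf{Ya}$ exchanged. $\vdash_{\mathsf{PiL}}\Gamma$ means $\emptyset\vdash\Gamma$ is derivable. *)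

(* Defs.v *)
From Stdlib Require Import List Permutation Relation_Operators.
From mathcomp Require Import all_boot finmap.

Set Implicit Arguments.
Unset Strict Implicit.
Unset Printing Implicit Defensive.

(* Syntax is represented modulo alpha-equivalence by nested datatypes: the
   argument of a binder lives over [option N], where [None] is the bound name
   and [Some x] is the name [x] of the enclosing scope.  So [proc label N] is
   the type of alpha-classes of processes whose free names are in [N]; when
   N is infinite, every such class has clean (unambiguous) representatives.  Renamings act
   functorially and cannot capture.
   The functions [p_nu x P], [p_in x y P], [f_all x A], and so on bind a
   named variable, so that the rules below read as on paper. *)

Definition infinite (T : eqType) : Prop := forall s : seq T, exists x, x \notin s.

(* x |-> None, and y |-> Some y for y <> x *)
Definition bind (T : eqType) (x y : T) : option T :=
  if y == x then None else Some y.

(* b |-> a, and y |-> y for y <> b; this is the renaming [a/b] *)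
Definition repl (T : eqType) (a b y : T) : T := if y == b then a else y.

Definition lset (label : finType) : Type := {L : {set label} | L != set0}.

Definition idx (label : finType) (L : lset label) : finType :=
  {l : label | l \in val L}.

Lemma idx_gt0 (label : finType) (L : lset label) : 0 < #|idx L|.
Proof.
by case: L => L L0; rewrite card_sig; case/set0Pn: (L0) => l lL; apply/card_gt0P; exists l.
Qed.

Lemma set1_neq0 (label : finType) (k : label) : [set k] != set0.
Proof. by apply/set0Pn; exists k; rewrite set11. Qed.

Definition lset1 (label : finType) (k : label) : lset label :=
  exist _ [set k] (set1_neq0 k).

Definition idx1 (label : finType) (k : label) : idx (lset1 k) :=
  exist _ k (set11 k).

Inductive proc (label : finType) (N : Type) : Type :=
| PNil
| POut of N & N & proc label N              (* x!<y>.P *)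
| PIn of N & proc label (option N)          (* x?(y).P; the subject is not bound *)
| PPar of proc label N & proc label N
| PNu of proc label (option N)
| PSel (x : N) (L : lset label) (F : idx L -> proc label N)    (* x <| {l : P_l} *)
| PBra (x : N) (L : lset label) (F : idx L -> proc label N).   (* x |> {l : P_l} *)

Arguments PNil {label N}.
Arguments PSel {label N} x {L} F.
Arguments PBra {label N} x {L} F.

Fixpoint map_proc (label : finType) (N M : Type) (f : N -> M) (P : proc label N) :
    proc label M :=
  match P with
  | PNil => PNil
  | POut x y P => POut (f x) (f y) (map_proc f P)
  | PIn x P => PIn (f x) (map_proc (omap f) P)
  | PPar P Q => PPar (map_proc f P) (map_proc f Q)
  | PNu P => PNu (map_proc (omap f) P)
  | PSel x L F => PSel (f x) (fun l => map_proc f (F l))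
  | PBra x L F => PBra (f x) (fun l => map_proc f (F l))
  end.

Fixpoint free_proc (label : finType) (N : Type) (x : N) (P : proc label N) : Prop :=
  match P with
  | PNil => False
  | POut y z P => [\/ x = y, x = z | free_proc x P]
  | PIn y P => x = y \/ free_proc (Some x) P
  | PPar P Q => free_proc x P \/ free_proc x Q
  | PNu P => free_proc (Some x) P
  | PSel y _ F | PBra y _ F => x = y \/ exists l, free_proc x (F l)
  end.

Definition p_nu (label : finType) (N : eqType) (x : N) (P : proc label N) : proc label N :=
  PNu (map_proc (bind x) P).

Definition p_in (label : finType) (N : eqType) (x y : N) (P : proc label N) : proc label N :=
  PIn x (map_proc (bind y) P).

(* P[a/b] *)
Definition p_subst (label : finType) (N : eqType) (a b : N) (P : proc label N) :
    proc label N :=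
  map_proc (repl a b) P.

Inductive scong (label : finType) (N : eqType) : proc label N -> proc label N -> Prop :=
| sc_comm P Q : scong (PPar P Q) (PPar Q P)
| sc_assoc P Q R : scong (PPar (PPar P Q) R) (PPar P (PPar Q R))
| sc_assoc_inv P Q R : scong (PPar P (PPar Q R)) (PPar (PPar P Q) R)
| sc_nu_swap x y P : scong (p_nu x (p_nu y P)) (p_nu y (p_nu x P))
| sc_nil P : scong (PPar P PNil) P
| sc_nu_drop x S : ~ free_proc x S -> scong (p_nu x S) S
| sc_nu_extr x P S : ~ free_proc x S ->
    scong (PPar (p_nu x P) S) (p_nu x (PPar P S))
| sc_ctx_out x y P P' : scong P P' -> scong (POut x y P) (POut x y P')
| sc_ctx_in x y P P' : scong P P' -> scong (p_in x y P) (p_in x y P')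
| sc_ctx_parl P P' Q : scong P P' -> scong (PPar P Q) (PPar P' Q)
| sc_ctx_parr P Q Q' : scong Q Q' -> scong (PPar P Q) (PPar P Q')
| sc_ctx_nu x P P' : scong P P' -> scong (p_nu x P) (p_nu x P')
| sc_ctx_sel x L (F F' : idx L -> proc label N) k :
    scong (F k) (F' k) -> (forall l, l != k -> F' l = F l) ->
    scong (PSel x F) (PSel x F')
| sc_ctx_bra x L (F F' : idx L -> proc label N) k :
    scong (F k) (F' k) -> (forall l, l != k -> F' l = F l) ->
    scong (PBra x F) (PBra x F').

Definition scongs (label : finType) (N : eqType) : proc label N -> proc label N -> Prop :=
  clos_refl_trans (proc label N) (@scong label N).

Inductive core := CCom | CChoice | CLabel.

(* [step s c P P']: there is a derivation of P -> P' whose core-reduction is an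
   instance of c; if s is false, then it does not use the rule Struc. *)
Inductive step (label : finType) (N : eqType) :
    bool -> core -> proc label N -> proc label N -> Prop :=
| step_com s x a b P Q :
    step s CCom (PPar (POut x a P) (p_in x b Q)) (PPar P (p_subst a b Q))
| step_choice s x L (F : idx L -> proc label N) (k : idx L) :
    step s CChoice (PSel x F) (PSel x (fun _ : idx (lset1 (val k)) => F k))
| step_label s x L (k : idx L) (F : idx (lset1 (val k)) -> proc label N)
    (G : idx L -> proc label N) :
    step s CLabel (PPar (PSel x F) (PBra x G)) (PPar (F (idx1 (val k))) (G k))
| step_res s c x P P' : step s c P P' -> step s c (p_nu x P) (p_nu x P')
| step_par s c P P' Q : step s c P P' -> step s c (PPar P Q) (PPar P' Q)
| step_struc c P P' Q : scongs P P' -> P' <> P -> step false c P' Q ->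
    step true c P Q.

Definition reduces (label : finType) (N : eqType) (P P' : proc label N) : Prop :=
  exists c, step true c P P'.

Inductive term (label : finType) (V : Type) : Type :=
| TVar of V
| TLab of label.

Arguments TVar {label V}.
Arguments TLab {label V}.

Inductive nominal := New | Ya.

Definition dual (q : nominal) : nominal := if q is New then Ya else New.

Inductive form (label : finType) (V : Type) : Type :=
| FUnit
| FSnd of V & term label V                  (* <x!t> *)
| FRcv of V & term label V                  (* (x?t) *)
| FPar of form label V & form label V
| FTens of form label V & form label V
| FSeq of form label V & form label V       (* A <| B, the noncommutative connective *)
| FPlus (I : finType) (I0 : 0 < #|I|) (F : I -> form label V)
| FWith (I : finType) (I0 : 0 < #|I|) (F : I -> form label V)
| FAll of form label (option V)
| FEx of form label (option V)
| FNom of nominal & form label (option V).  (* New x.A and Ya x.A *)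

Arguments FUnit {label V}.
Arguments FPlus {label V I} I0 F.
Arguments FWith {label V I} I0 F.

Definition map_term (label : finType) (V W : Type) (f : V -> W) (t : term label V) :
    term label W :=
  match t with TVar x => TVar (f x) | TLab l => TLab l end.

Fixpoint map_form (label : finType) (V W : Type) (f : V -> W) (A : form label V) :
    form label W :=
  match A with
  | FUnit => FUnit
  | FSnd x t => FSnd (f x) (map_term f t)
  | FRcv x t => FRcv (f x) (map_term f t)
  | FPar A B => FPar (map_form f A) (map_form f B)
  | FTens A B => FTens (map_form f A) (map_form f B)
  | FSeq A B => FSeq (map_form f A) (map_form f B)
  | FPlus J J0 F => FPlus J0 (fun i => map_form f (F i))
  | FWith J J0 F => FWith J0 (fun i => map_form f (F i))
  | FAll A => FAll (map_form (omap f) A)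
  | FEx A => FEx (map_form (omap f) A)
  | FNom q A => FNom q (map_form (omap f) A)
  end.

Fixpoint free_form (label : finType) (V : Type) (x : V) (A : form label V) : Prop :=
  match A with
  | FUnit => False
  | FSnd y t | FRcv y t => x = y \/ t = TVar x
  | FPar A B | FTens A B | FSeq A B => free_form x A \/ free_form x B
  | FPlus _ _ F | FWith _ _ F => exists i, free_form x (F i)
  | FAll A | FEx A | FNom _ A => free_form (Some x) A
  end.

Definition fresh (label : finType) (V : Type) (x : V) (Gamma : seq (form label V)) : Prop :=
  List.Forall (fun A => ~ free_form x A) Gamma.

Definition f_all (label : finType) (V : eqType) (x : V) (A : form label V) : form label V :=
  FAll (map_form (bind x) A).

Definition f_ex (label : finType) (V : eqType) (x : V) (A : form label V) : form label V :=
  FEx (map_form (bind x) A).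

Definition f_nom (label : finType) (V : eqType) (q : nominal) (x : V) (A : form label V) :
    form label V :=
  FNom q (map_form (bind x) A).

(* A[y/x] *)
Definition f_subst (label : finType) (V : eqType) (y x : V) (A : form label V) :
    form label V :=
  map_form (repl y x) A.

Fixpoint neg (label : finType) (V : Type) (A : form label V) : form label V :=
  match A with
  | FUnit => FUnit
  | FSnd x t => FRcv x t
  | FRcv x t => FSnd x t
  | FPar A B => FTens (neg A) (neg B)
  | FTens A B => FPar (neg A) (neg B)
  | FSeq A B => FSeq (neg A) (neg B)
  | FPlus J J0 F => FWith J0 (fun i => neg (F i))
  | FWith J J0 F => FPlus J0 (fun i => neg (F i))
  | FAll A => FEx (neg A)
  | FEx A => FAll (neg A)
  | FNom q A => FNom (dual q) (neg A)
  end.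

Definition lolli (label : finType) (V : Type) (A B : form label V) : form label V :=
  FPar (neg A) B.

(* The argument i : N -> V is the inclusion of names into variables. *)
Fixpoint tr (label : finType) (N V : Type) (i : N -> V) (P : proc label N) :
    form label V :=
  match P with
  | PNil => FUnit
  | POut x y P => FSeq (FSnd (i x) (TVar (i y))) (tr i P)
  | PIn x P => FEx (FSeq (FRcv (Some (i x)) (TVar None)) (tr (omap i) P))
  | PPar P Q => FPar (tr i P) (tr i Q)
  | PNu P => FNom New (tr (omap i) P)
  | PSel x L F =>
      FWith (idx_gt0 L) (fun l => FSeq (FSnd (i x) (TLab (val l))) (tr i (F l)))
  | PBra x L F =>
      FPlus (idx_gt0 L) (fun l => FSeq (FRcv (i x) (TLab (val l))) (tr i (F l)))
  end.

(* S.[x <- New] is the store S extended with the element x^New, and S1 + S2 is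
   the union of S1 and S2, used only for disjoint domains. *)
Definition store (V : choiceType) : Type := {fmap V -> nominal}.

Definition disjoint_stores (V : choiceType) (S1 S2 : store V) : Prop :=
  fdisjoint (domf S1) (domf S2).

(* Sequents are lists up to permutation (rule [d_exch]).  Each of the rules
   [d_nom], [d_load], [d_pop] is the pair of rules for the two nominal
   quantifiers.  In [d_pop], q is the tag in the store, so that the principal
   quantifier is the dual one. *)
Inductive derivable (label : finType) (V : choiceType) :
    store V -> seq (form label V) -> Prop :=
| d_exch S Gamma Delta : Permutation Gamma Delta ->
    derivable S Gamma -> derivable S Delta
| d_ax S x t : derivable S [:: FSnd x t; FRcv x t]
| d_unit S : derivable S [:: FUnit]
| d_par S Gamma A B :
    derivable S (A :: B :: Gamma) -> derivable S (FPar A B :: Gamma)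
| d_tens S1 S2 Gamma Delta A B : disjoint_stores S1 S2 ->
    derivable S1 (A :: Gamma) -> derivable S2 (B :: Delta) ->
    derivable (S1 + S2)%fset (FTens A B :: Gamma ++ Delta)
| d_mix S1 S2 Gamma Delta : disjoint_stores S1 S2 ->
    derivable S1 Gamma -> derivable S2 Delta ->
    derivable (S1 + S2)%fset (Gamma ++ Delta)
| d_plus S Gamma (I : finType) (I0 : 0 < #|I|) (F : I -> form label V) (k : I) :
    derivable S (F k :: Gamma) -> derivable S (FPlus I0 F :: Gamma)
| d_with S Gamma (I : finType) (I0 : 0 < #|I|) (F : I -> form label V) :
    (forall i, derivable S (F i :: Gamma)) -> derivable S (FWith I0 F :: Gamma)
| d_all S Gamma x A : fresh x Gamma ->
    derivable S (A :: Gamma) -> derivable S (f_all x A :: Gamma)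
| d_ex S Gamma x y A :
    derivable S (f_subst y x A :: Gamma) -> derivable S (f_ex x A :: Gamma)
| d_seq S1 S2 Gamma Delta A B C D : disjoint_stores S1 S2 ->
    derivable S1 (A :: C :: Gamma) -> derivable S2 (B :: D :: Delta) ->
    derivable (S1 + S2)%fset (FSeq A B :: FSeq C D :: Gamma ++ Delta)
| d_seq_unit S1 S2 Gamma Delta A B : disjoint_stores S1 S2 ->
    derivable S1 (A :: Gamma) -> derivable S2 (B :: Delta) ->
    derivable (S1 + S2)%fset (FSeq A B :: Gamma ++ Delta)
| d_nom S Gamma q x A : fresh x Gamma ->
    derivable S (A :: Gamma) -> derivable S (f_nom q x A :: Gamma)
| d_load S Gamma q x A : x \notin domf S -> fresh x Gamma ->
    derivable S.[x <- q]%fmap (A :: Gamma) -> derivable S (f_nom q x A :: Gamma)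
| d_pop S Gamma q x y A : y \notin domf S ->
    derivable S (f_subst y x A :: Gamma) ->
    derivable S.[y <- q]%fmap (f_nom (dual q) x A :: Gamma).

Definition provable (label : finType) (V : choiceType) (A : form label V) : Prop :=
  derivable (fmap0 : store V) [:: A].

(* Main.v *)
(* No cut rule is available, so P ==>* P' cannot be treated one step at a time
   by composing derivations.  Instead, a sequent [P']^bot, [P] is derived by
   first opening P completely (par, New_load), which leaves a store X of private
   names and a list G of prefixed threads, and then decomposing [P']^bot (tensor,
   Ya_pop), which distributes X and G and ends by matching prefixes one to one.
   The existence of such a matching is the relation [covers].  It is reflexive
   (once P is opened) and preserved by structural precongruence on its right-hand
   process, which makes chains of steps harmless; reductions are then handled by
   induction on the step, starting from a matching for the redex. *)

From Stdlib Require Import Permutation FunctionalExtensionality.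
Require Import Defs.
From mathcomp Require Import all_boot finmap.

Set Implicit Arguments.
Unset Strict Implicit.
Unset Printing Implicit Defensive.

(** * Functoriality of renaming, and its compatibility with translation and negation *)

Lemma map_proc_comp (label : finType) (N M T : Type) (f : N -> M) (g : M -> T)
    (P : proc label N) : map_proc g (map_proc f P) = map_proc (g \o f) P.
Proof.
elim: P M T f g => {N} [N|N x y P IH|N x P IH|N P IHP Q IHQ|N P IH|N x L F IH|N x L F IH]
  M T f g //=; rewrite ?IHP ?IHQ ?IH //.
- by congr PIn; congr map_proc; apply: functional_extensionality => -[].
- by congr PNu; congr map_proc; apply: functional_extensionality => -[].
- by congr PSel; apply: functional_extensionality => l; rewrite IH.
- by congr PBra; apply: functional_extensionality => l; rewrite IH.
Qed.

Lemma tr_map_proc (label : finType) (N M V : Type) (f : N -> M) (i : M -> V)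
    (P : proc label N) : tr i (map_proc f P) = tr (i \o f) P.
Proof.
elim: P M V f i => {N} [N|N x y P IH|N x P IH|N P IHP Q IHQ|N P IH|N x L F IH|N x L F IH]
  M V f i //=; rewrite ?IHP ?IHQ ?IH //.
- congr (FEx (FSeq _ _)); congr tr; by apply: functional_extensionality => -[].
- by congr FNom; congr tr; apply: functional_extensionality => -[].
- by congr FWith; apply: functional_extensionality => l; rewrite IH.
- by congr FPlus; apply: functional_extensionality => l; rewrite IH.
Qed.

Lemma map_form_tr (label : finType) (N V W : Type) (i : N -> V) (f : V -> W)
    (P : proc label N) : map_form f (tr i P) = tr (f \o i) P.
Proof.
elim: P V W i f => {N} [N|N x y P IH|N x P IH|N P IHP Q IHQ|N P IH|N x L F IH|N x L F IH]
  V W i f //=; rewrite ?IHP ?IHQ ?IH //.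
- congr (FEx (FSeq _ _)); congr tr; by apply: functional_extensionality => -[].
- by congr FNom; congr tr; apply: functional_extensionality => -[].
- by congr FWith; apply: functional_extensionality => l; rewrite IH.
- by congr FPlus; apply: functional_extensionality => l; rewrite IH.
Qed.

Lemma map_form_neg (label : finType) (V W : Type) (f : V -> W) (A : form label V) :
  map_form f (neg A) = neg (map_form f A).
Proof.
elim: A W f => {V} [V|V x t|V x t|V A IHA B IHB|V A IHA B IHB|V A IHA B IHB
  |V I I0 F IH|V I I0 F IH|V A IH|V A IH|V q A IH] W f //=; rewrite ?IHA ?IHB ?IH //.
- by congr FWith; apply: functional_extensionality => l; rewrite IH.
- by congr FPlus; apply: functional_extensionality => l; rewrite IH.
Qed.

Lemma map_form_comp (label : finType) (V W X : Type) (f : V -> W) (g : W -> X)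
    (A : form label V) : map_form g (map_form f A) = map_form (g \o f) A.
Proof.
have omap_comp (T U Z : Type) (h : T -> U) (k : U -> Z) : omap k \o omap h = omap (k \o h).
  by apply: functional_extensionality => -[].
elim: A W X f g => {V} [V|V x t|V x t|V A IHA B IHB|V A IHA B IHB|V A IHA B IHB
  |V I I0 F IH|V I I0 F IH|V A IH|V A IH|V q A IH] W X f g //=;
  rewrite ?IHA ?IHB ?IH ?omap_comp //; try by case: t.
- by congr FPlus; apply: functional_extensionality => l; rewrite IH.
- by congr FWith; apply: functional_extensionality => l; rewrite IH.
Qed.

Lemma eq_map_form (label : finType) (V W : Type) (f g : V -> W) (A : form label V) :
  (forall x, free_form x A -> f x = g x) -> map_form f A = map_form g A.
Proof.
elim: A W f g => {V} [V|V x t|V x t|V A IHA B IHB|V A IHA B IHB|V A IHA B IHB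
  |V I I0 F IH|V I I0 F IH|V A IH|V A IH|V q A IH] W f g //= fg.
- congr FSnd; first by apply: fg; left.
  by case: t fg => //= y fg; rewrite (fg y) //; right.
- congr FRcv; first by apply: fg; left.
  by case: t fg => //= y fg; rewrite (fg y) //; right.
- by congr FPar; [apply: IHA|apply: IHB] => x xF; apply: fg; [left|right].
- by congr FTens; [apply: IHA|apply: IHB] => x xF; apply: fg; [left|right].
- by congr FSeq; [apply: IHA|apply: IHB] => x xF; apply: fg; [left|right].
- congr FPlus; apply: functional_extensionality => l; apply: IH => x xF.
  by apply: fg; exists l.
- congr FWith; apply: functional_extensionality => l; apply: IH => x xF.
  by apply: fg; exists l.
- by congr FAll; apply: IH => -[x|] //= xF; rewrite fg.
- by congr FEx; apply: IH => -[x|] //= xF; rewrite fg.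
- by congr FNom; apply: IH => -[x|] //= xF; rewrite fg.
Qed.

Lemma map_form_id (label : finType) (V : Type) (A : form label V) : map_form id A = A.
Proof.
have omap_idE (T : Type) : omap id = id :> (option T -> option T).
  by apply: functional_extensionality => -[].
elim: A => {V} [V|V x t|V x t|V A IHA B IHB|V A IHA B IHB|V A IHA B IHB
  |V I I0 F IH|V I I0 F IH|V A IH|V A IH|V q A IH] //=;
  rewrite ?IHA ?IHB ?omap_idE ?IH //; try by case: t.
- by congr FPlus; apply: functional_extensionality => l; rewrite IH.
- by congr FWith; apply: functional_extensionality => l; rewrite IH.
Qed.

(** * Free variables and fresh names *)

Definition term_vars (label : finType) (V : Type) (t : term label V) : seq V :=
  if t is TVar x then [:: x] else [::].

(** Free variables are collected in a list so that [infinite] can supply a variable outside it;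
    [pmap id] discards the bound [None] and strips [Some] from the rest. *)
Fixpoint form_vars (label : finType) (V : Type) (A : form label V) : seq V :=
  match A with
  | FUnit => [::]
  | FSnd x t | FRcv x t => x :: term_vars t
  | FPar A B | FTens A B | FSeq A B => form_vars A ++ form_vars B
  | FPlus J _ F | FWith J _ F => flatten [seq form_vars (F j) | j <- enum J]
  | FAll A | FEx A | FNom _ A => pmap id (form_vars A)
  end.

Lemma free_form_vars (label : finType) (V : eqType) (x : V) (A : form label V) :
  free_form x A -> x \in form_vars A.
Proof.
have Hlab (W : eqType) (y : W) (t : term label W) : t = TVar y -> y \in term_vars t.
  by move=> ->; rewrite inE.
have Hopt (W : eqType) (y : W) s : Some y \in s -> y \in pmap id s.
  by move=> ys; rewrite mem_pmap; apply/mapP; exists (Some y).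
(* Induction on a nested datatype changes the carrier to [option W], a bare type without decidable
   equality. Renaming into an arbitrary [eqType] along [h] makes membership meaningful in every
   case. *)
move: V x A; suff H (W : Type) (A : form label W) (V : eqType) (h : W -> V) x :
    free_form x (map_form h A) -> x \in form_vars (map_form h A).
  by move=> V x A; have := H V A V id x; rewrite map_form_id.
elim: A V h x => {W} [V|V y t|V y t|V A IHA B IHB|V A IHA B IHB|V A IHA B IHB
  |V I I0 F IH|V I I0 F IH|V A IH|V A IH|V q A IH] W h x //=.
- by case=> [->|/Hlab]; rewrite inE ?eqxx // => ->; rewrite orbT.
- by case=> [->|/Hlab]; rewrite inE ?eqxx // => ->; rewrite orbT.
- by case=> [/IHA|/IHB]; rewrite mem_cat => ->; rewrite ?orbT.
- by case=> [/IHA|/IHB]; rewrite mem_cat => ->; rewrite ?orbT.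
- by case=> [/IHA|/IHB]; rewrite mem_cat => ->; rewrite ?orbT.
- by case=> l /IH xl; apply/flatten_mapP; exists l; rewrite ?mem_enum.
- by case=> l /IH xl; apply/flatten_mapP; exists l; rewrite ?mem_enum.
- by move/IH => xl; apply: Hopt.
- by move/IH => xl; apply: Hopt.
- by move/IH => xl; apply: Hopt.
Qed.

Lemma fresh_exists (label : finType) (V : eqType) (s : seq V) (Gamma : seq (form label V)) :
  infinite V -> exists x, x \notin s /\ fresh x Gamma.
Proof.
move=> Vinf; have [x] := Vinf (s ++ flatten (map (@form_vars label V) Gamma)).
rewrite mem_cat negb_or => /andP[xs xG]; exists x; split=> //.
elim: Gamma xG => [|A G IH] /=; first by constructor.
rewrite mem_cat negb_or => /andP[xA /IH xG]; constructor=> //.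
by move/free_form_vars; apply/negP.
Qed.

(** * Instantiation of nested binders, and rules for them *)

Definition inst (label : finType) (V : Type) (y : V) (A : form label (option V)) :
  form label V := map_form (oapp id y) A.

(** A binder body is thus recovered from its instance at a fresh name, so the rules, which bind
    named variables, apply to a raw [FAll], [FEx] or [FNom]. *)
Lemma bind_inst (label : finType) (V : eqType) (x : V) (A : form label (option V)) :
  ~ free_form (Some x) A -> map_form (bind x) (inst x A) = A.
Proof.
move=> xA; rewrite /inst map_form_comp -[RHS]map_form_id; apply: eq_map_form => -[y|] /=.
  by rewrite /bind; case: eqP => // -> /xA.
by rewrite /bind eqxx.
Qed.

Lemma subst_inst (label : finType) (V : eqType) (x y : V) (A : form label (option V)) :
  ~ free_form (Some x) A -> f_subst y x (inst x A) = inst y A.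
Proof.
move=> xA; rewrite /f_subst /inst map_form_comp; apply: eq_map_form => -[z|] /=.
  by rewrite /repl; case: eqP => // -> /xA.
by rewrite /repl eqxx.
Qed.

Lemma inst_tr (label : finType) (N V : Type) (e : N -> V) (y : V)
    (P : proc label (option N)) : inst y (tr (omap e) P) = tr (oapp e y) P.
Proof.
rewrite /inst map_form_tr; congr tr.
by apply: functional_extensionality => -[].
Qed.

Lemma inst_neg_tr (label : finType) (N V : Type) (e : N -> V) (y : V)
    (P : proc label (option N)) : inst y (neg (tr (omap e) P)) = neg (tr (oapp e y) P).
Proof. by rewrite /inst map_form_neg -/(inst _ _) inst_tr. Qed.

Lemma oapp_bind (N : eqType) (V : Type) (e : N -> V) (x : N) (y : V) :
  oapp e y \o bind x = fun z => if z == x then y else e z.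
Proof. by apply: functional_extensionality => z /=; rewrite /bind; case: eqP. Qed.

Section DerivedRules.
Variables (label : finType) (V : choiceType).
Hypothesis V_inf : infinite V.
Implicit Types (S : store V) (Gamma : seq (form label V)) (B : form label (option V)).

Lemma derivable_all S Gamma B x :
  fresh x (FAll B :: Gamma) ->
  derivable S (inst x B :: Gamma) -> derivable S (FAll B :: Gamma).
Proof.
by move=> xG; inversion_clear xG as [|? ? xB xG']; rewrite -{2}(bind_inst xB); apply: d_all.
Qed.

(** The fresh [x] only gives the raw binder a name; the witness [y] is arbitrary and need not be
    fresh. *)
Lemma derivable_ex S Gamma B y :
  derivable S (inst y B :: Gamma) -> derivable S (FEx B :: Gamma).
Proof.
have [x [_ xG]] := fresh_exists [::] [:: FEx B] V_inf.
inversion_clear xG as [|? ? xB _].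
by rewrite -(subst_inst y xB) -{2}(bind_inst xB); apply: d_ex.
Qed.

Lemma derivable_load S Gamma q B x :
  x \notin domf S -> fresh x (FNom q B :: Gamma) ->
  derivable S.[x <- q]%fmap (inst x B :: Gamma) -> derivable S (FNom q B :: Gamma).
Proof.
move=> xS xG; inversion_clear xG as [|? ? xB xG'].
by rewrite -{2}(bind_inst xB); apply: d_load.
Qed.

Lemma derivable_pop S Gamma q B y :
  y \notin domf S -> derivable S (inst y B :: Gamma) ->
  derivable S.[y <- q]%fmap (FNom (dual q) B :: Gamma).
Proof.
have [x [_ xG]] := fresh_exists [::] [:: FNom q B] V_inf.
inversion_clear xG as [|? ? xB _] => yS.
by rewrite -(subst_inst y xB) -{2}(bind_inst xB); apply: d_pop.
Qed.

(** The translation produces only [New], and its negation only [Ya], so every stored name carries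
    the tag [New] and is popped by a [Ya]. *)
Definition new_store (X : seq V) : store V := foldr (fun x S => S.[x <- New]%fmap) fmap0 X.

Lemma new_storeE X x : (new_store X).[? x]%fmap = if x \in X then Some New else None.
Proof.
elim: X => [|y X IH] /=; first by rewrite fnd_fmap0.
by rewrite fnd_set inE IH; case: eqP.
Qed.

Lemma mem_new_store X x : (x \in domf (new_store X)) = (x \in X).
Proof. by rewrite -fndSome new_storeE; case: ifP. Qed.

Lemma perm_new_store X Y : perm_eq X Y -> new_store X = new_store Y.
Proof. by move=> XY; apply/fmapP => x; rewrite !new_storeE (perm_mem XY). Qed.

Lemma new_store_cat X Y : new_store (X ++ Y) = (new_store X + new_store Y)%fset.
Proof.
apply/fmapP => x; rewrite fnd_cat !new_storeE mem_cat mem_new_store.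
by case: (x \in X); case: (x \in Y).
Qed.

Lemma disjoint_new_store X Y : uniq (X ++ Y) -> disjoint_stores (new_store X) (new_store Y).
Proof.
rewrite cat_uniq => /and3P[_ /hasPn XY _]; apply/fdisjointP => x.
rewrite !mem_new_store => xX; apply/negP => /XY /negP; exact.
Qed.

End DerivedRules.

(** * Opening a process and matching its threads *)

(* Flattening in continuation-passing style: X accumulates the opened
   restrictions, G the top-level threads.  The opened names are arbitrary, not
   fresh, so that no freshness condition has to be maintained; only
   [opens_sound] chooses them fresh. *)
Fixpoint opens (label : finType) (V M : Type) (e : M -> V) (P : proc label M)
    (phi : seq V -> seq (proc label V) -> Prop) (X : seq V) (G : seq (proc label V)) :
    Prop :=
  match P with
  | PNil => phi X G
  | PPar P Q => opens e P (opens e Q phi) X G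
  | PNu P => forall x, opens (oapp e x) P phi (x :: X) G
  | POut _ _ _ | PIn _ _ | PSel _ _ _ | PBra _ _ _ => phi X (map_proc e P :: G)
  end.

(* [covers e Q X G]: Q is obtained by instantiating its top-level restrictions
   with distinct elements of X and matching its threads with those in G, each
   prefix with the same prefix and each continuation recursively. *)
Fixpoint covers (label : finType) (V : eqType) (M : Type) (e : M -> V) (Q : proc label M)
    (X : seq V) (G : seq (proc label V)) : Prop :=
  match Q with
  | PNil => G = [::]
  | PPar Q R => exists X1 X2 G1 G2,
      [/\ perm_eq X (X1 ++ X2), Permutation G (G1 ++ G2), covers e Q X1 G1 & covers e R X2 G2]
  | PNu Q => exists y X', perm_eq X (y :: X') /\ covers (oapp e y) Q X' G
  | POut x y Q => exists P, G = [:: POut (e x) (e y) P] /\ opens id P (covers e Q) [::] [::]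
  | PIn x Q => exists P, G = [:: PIn (e x) P] /\
      forall z, opens (oapp id z) P (covers (oapp e z) Q) [::] [::]
  | PSel x L F => exists F', G = [:: PSel (e x) F'] /\
      forall l : idx L, opens id (F' l) (covers e (F l)) [::] [::]
  | PBra x L F => exists F', G = [:: PBra (e x) F'] /\
      forall l : idx L, opens id (F' l) (covers e (F l)) [::] [::]
  end.

Lemma opens_impl (label : finType) (V M : Type) (e : M -> V) (P : proc label M)
    (phi psi : seq V -> seq (proc label V) -> Prop) :
  (forall X G, phi X G -> psi X G) -> forall X G, opens e P phi X G -> opens e P psi X G.
Proof.
elim: P e phi psi => {M} [M|M x y P IH|M x P IH|M P IHP Q IHQ|M P IH|M x L F IH|M x L F IH]
  e phi psi H X G //=; try exact: H.
  by apply: IHP; apply: IHQ.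
by move=> K x; apply: IH (K x).
Qed.

(** This is an equality of predicates because, for a parallel composition, one opening is the
    continuation of the other and has to be rewritten in place. *)
Lemma opens_map (label : finType) (V M T : Type) (f : M -> T) (e : T -> V)
    (P : proc label M) (phi : seq V -> seq (proc label V) -> Prop) :
  opens e (map_proc f P) phi = opens (e \o f) P phi.
Proof.
elim: P T f e phi => {M} [M|M x y P IH|M x P IH|M P IHP Q IHQ|M P IH|M x L F IH|M x L F IH]
  T f e phi //=.
- apply: functional_extensionality => X; apply: functional_extensionality => G.
  by rewrite map_proc_comp.
- apply: functional_extensionality => X; apply: functional_extensionality => G.
  rewrite map_proc_comp; congr (phi _ (PIn _ (map_proc _ _) :: _)).
  by apply: functional_extensionality => -[].
- by rewrite IHP IHQ.
- apply: functional_extensionality => X; apply: functional_extensionality => G.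
  have E x : oapp e x \o omap f = oapp (e \o f) x.
    by apply: functional_extensionality => -[].
  (* Equality of the bodies is lifted through the quantifier by function extensionality. *)
  suff eq_all (A B : V -> Prop) : A =1 B -> (forall x, A x) = (forall x, B x).
    by apply: eq_all => x; rewrite IH E.
  by move/functional_extensionality ->.
- apply: functional_extensionality => X; apply: functional_extensionality => G.
  congr (phi _ (PSel _ _ :: _)).
  by apply: functional_extensionality => l; rewrite map_proc_comp.
- apply: functional_extensionality => X; apply: functional_extensionality => G.
  congr (phi _ (PBra _ _ :: _)).
  by apply: functional_extensionality => l; rewrite map_proc_comp.
Qed.

Lemma covers_map (label : finType) (V : eqType) (M T : Type) (f : M -> T) (e : T -> V)
    (P : proc label M) X G : covers e (map_proc f P) X G <-> covers (e \o f) P X G.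
Proof.
have E (A B : Type) (h : A -> B) (d : B -> V) x : oapp d x \o omap h = oapp (d \o h) x.
  by apply: functional_extensionality => -[].
elim: P T f e X G => {M} [M|M x y P IH|M x P IH|M P IHP Q IHQ|M P IH|M x L F IH|M x L F IH]
  T f e X G //=.
- by split=> -[P' [-> H]]; exists P'; split=> //; apply: opens_impl H => *; apply/IH.
- split=> -[P' [-> H]]; exists P'; split=> // z; apply: opens_impl (H z) => X' G'.
    by rewrite -E => /IH.
  by rewrite -E => ?; apply/IH.
- by split=> -[X1 [X2 [G1 [G2 [? ? /IHP ? /IHQ ?]]]]]; exists X1, X2, G1, G2.
- by split=> -[y [X' [? H]]]; exists y, X'; split=> //; move: H; rewrite -E IH.
- by split=> -[F' [-> H]]; exists F'; split=> // l; apply: opens_impl (H l) => *; apply/IH.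
- by split=> -[F' [-> H]]; exists F'; split=> // l; apply: opens_impl (H l) => *; apply/IH.
Qed.

(** Agreement is asked on free names only, which is how the side conditions of the scope laws
    enter. *)
Lemma covers_ext (label : finType) (V : eqType) (M : Type) (e e' : M -> V)
    (P : proc label M) X G :
  (forall x, free_proc x P -> e x = e' x) -> covers e P X G -> covers e' P X G.
Proof.
elim: P e e' X G => {M} [M|M x y P IH|M x P IH|M P IHP Q IHQ|M P IH|M x L F IH|M x L F IH]
  e e' X G //= ee'.
- case=> P' [-> H]; exists P'; rewrite !ee'; [|by constructor..].
  split=> //; apply: opens_impl H => X' G'; apply: IH => z zP.
  by apply: ee'; constructor.
- case=> P' [-> H]; exists P'; rewrite ee'; [|by left].
  split=> // z; apply: opens_impl (H z) => X' G'; apply: IH => -[w|] //= wP.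
  by apply: ee'; right.
- case=> X1 [X2 [G1 [G2 [? ? H1 H2]]]]; exists X1, X2, G1, G2; split=> //.
    by apply: IHP H1 => z zP; apply: ee'; left.
  by apply: IHQ H2 => z zP; apply: ee'; right.
- case=> y [X' [? H]]; exists y, X'; split=> //.
  by apply: IH H => -[w|] //= wP; apply: ee'.
- case=> F' [-> H]; exists F'; rewrite ee'; [|by left].
  split=> // l; apply: opens_impl (H l) => X' G'; apply: IH => z zP.
  by apply: ee'; right; exists l.
- case=> F' [-> H]; exists F'; rewrite ee'; [|by left].
  split=> // l; apply: opens_impl (H l) => X' G'; apply: IH => z zP.
  by apply: ee'; right; exists l.
Qed.

Lemma covers_perm (label : finType) (V : eqType) (M : Type) (e : M -> V)
    (P : proc label M) X Y G H :
  perm_eq Y X -> Permutation H G -> covers e P X G -> covers e P Y H.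
Proof.
elim: P e X Y G H => {M} [M|M x y P IH|M x P IH|M P IHP Q IHQ|M P IH|M x L F IH|M x L F IH]
  e X Y G H YX HG //=.
- by move=> GE; move: HG; rewrite GE => /Permutation_sym /Permutation_nil.
- case=> P' [GE K]; exists P'; split=> //.
  by apply: Permutation_length_1_inv; rewrite -GE; apply: Permutation_sym.
- case=> P' [GE K]; exists P'; split=> //.
  by apply: Permutation_length_1_inv; rewrite -GE; apply: Permutation_sym.
- case=> X1 [X2 [G1 [G2 [XE GE H1 H2]]]]; exists X1, X2, G1, G2; split=> //.
    exact: perm_trans XE.
  exact: Permutation_trans GE.
- case=> y [X' [XE K]]; exists y, X'; split; first exact: perm_trans XE.
  exact: IH K.
- case=> P' [GE K]; exists P'; split=> //.
  by apply: Permutation_length_1_inv; rewrite -GE; apply: Permutation_sym.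
- case=> P' [GE K]; exists P'; split=> //.
  by apply: Permutation_length_1_inv; rewrite -GE; apply: Permutation_sym.
Qed.

(** [Nil] and the prefixes put no condition on [X], just as axioms and units accept any store.
    Surplus names can therefore be pushed down to a leaf; they arise when a restriction or a [Nil]
    is dropped. *)
Lemma covers_weaken (label : finType) (V : eqType) (M : Type) (e : M -> V)
    (P : proc label M) Y X G : covers e P X G -> covers e P (Y ++ X) G.
Proof.
elim: P e Y X G => {M} [M|M x y P IH|M x P IH|M P IHP Q IHQ|M P IH|M x L F IH|M x L F IH]
  e Y X G //=.
- case=> X1 [X2 [G1 [G2 [XE GE H1 H2]]]]; exists (Y ++ X1), X2, G1, G2; split=> //.
    by rewrite -catA perm_cat2l.
  exact: IHP.
- case=> y [X' [XE K]]; exists y, (Y ++ X'); split; last exact: IH.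
  apply: (perm_trans (y := Y ++ y :: X')); first by rewrite perm_cat2l.
  exact/permPl/(perm_catCA Y [:: y] X').
Qed.

(** * Invariance of matchings under structural precongruence *)

Lemma covers_nu (label : finType) (N V : eqType) (e : N -> V) x (P : proc label N) X G :
  covers e (p_nu x P) X G <->
  exists y X', perm_eq X (y :: X') /\ covers (fun z => if z == x then y else e z) P X' G.
Proof.
rewrite /p_nu /=; split=> -[y [X' [XE H]]]; exists y, X'; split=> //.
  by rewrite -oapp_bind; apply/covers_map.
by apply/covers_map; rewrite oapp_bind.
Qed.

Lemma covers_scong (label : finType) (N V : eqType) (e : N -> V) (P Q : proc label N) X G :
  scong P Q -> covers e P X G -> covers e Q X G.
Proof.
move=> PQ; elim: PQ e X G => {P Q}.
- move=> P Q e X G /= [X1 [X2 [G1 [G2 [XE GE H1 H2]]]]]; exists X2, X1, G2, G1; split=> //.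
    by rewrite perm_sym perm_catC perm_sym.
  exact: Permutation_trans GE (Permutation_app_comm _ _).
- move=> P Q R e X G /= [X12 [X3 [G12 [G3 [XE GE [X1 [X2 [G1 [G2 [XE' GE' H1 H2]]]]] H3]]]]].
  exists X1, (X2 ++ X3), G1, (G2 ++ G3); split=> //; last by exists X2, X3, G2, G3; split.
    by rewrite catA (perm_trans XE) // perm_cat2r.
  by rewrite catA; apply: Permutation_trans GE (Permutation_app_tail _ GE').
- move=> P Q R e X G /= [X1 [X23 [G1 [G23 [XE GE H1 [X2 [X3 [G2 [G3 [XE' GE' H2 H3]]]]]]]]]].
  exists (X1 ++ X2), X3, (G1 ++ G2), G3; split=> //; last by exists X1, X2, G1, G2; split.
    by rewrite -catA (perm_trans XE) // perm_cat2l.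
  by rewrite -catA; apply: Permutation_trans GE (Permutation_app_head _ GE').
- move=> x y P e X G /covers_nu[u [X1 [XE /covers_nu[v [X2 [XE' H]]]]]].
  have XE2 : perm_eq X [:: u, v & X2] by rewrite (perm_trans XE) // perm_cons.
  (* If the names coincide, the inner binder shadows the outer one, both sides are the same process,
     and the witnesses keep their order; otherwise they are exchanged. *)
  have [xy|xy] := eqVneq x y.
    subst y; apply/covers_nu; exists u, X1; split=> //.
    by apply/covers_nu; exists v, X2; split=> //.
  apply/covers_nu; exists v, (u :: X2); split.
    apply: perm_trans XE2 _; exact/permPl/(perm_catCA [:: u] [:: v] X2).
  apply/covers_nu; exists u, X2; split=> //.
  apply: covers_ext H => z _; case: (z =P y) => // ->.
  by rewrite eq_sym (negbTE xy).
- move=> P e X G /= [X1 [X2 [G1 [G2 [XE GE H1 G2E]]]]].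
  subst G2; rewrite cats0 in GE; apply: (covers_perm _ GE) (covers_weaken X2 H1).
  by rewrite (perm_trans XE) // perm_catC.
- move=> x S xS e X G /covers_nu[y [X' [XE H]]].
  apply: (covers_perm XE (Permutation_refl _)).
  apply: (covers_weaken [:: y]); apply: covers_ext H => z zS.
  by case: eqP => // zx; subst z; case: xS.
- move=> x P S xS e X G [X1 [X2 [G1 [G2 [XE GE /covers_nu[y [X' [XE' H1]]] H2]]]]].
  apply/covers_nu; exists y, (X' ++ X2); split.
    by rewrite -cat_cons (perm_trans XE) // perm_cat2r.
  exists X', X2, G1, G2; split=> //; apply: covers_ext H2 => z zS.
  by case: eqP => // zx; subst z; case: xS.
- move=> x y P P' _ IH e X G /= [R [-> H]]; exists R; split=> //.
  by apply: opens_impl H; apply: IH.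
- move=> x y P P' _ IH e X G /= [R [-> H]]; exists R; split=> // z.
  by apply: opens_impl (H z) => X' G' /covers_map K; apply/covers_map; apply: IH.
- move=> P P' Q _ IH e X G /= [X1 [X2 [G1 [G2 [XE GE H1 H2]]]]].
  by exists X1, X2, G1, G2; split=> //; apply: IH.
- move=> P Q Q' _ IH e X G /= [X1 [X2 [G1 [G2 [XE GE H1 H2]]]]].
  by exists X1, X2, G1, G2; split=> //; apply: IH.
- move=> x P P' _ IH e X G /covers_nu[y [X' [XE H]]].
  by apply/covers_nu; exists y, X'; split=> //; apply: IH.
- move=> x L F F' k _ IH FF' e X G /= [R [-> H]]; exists R; split=> // l.
  have [->|lk] := eqVneq l k; first by apply: opens_impl (H k); apply: IH.
  by rewrite FF'.
- move=> x L F F' k _ IH FF' e X G /= [R [-> H]]; exists R; split=> // l.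
  have [->|lk] := eqVneq l k; first by apply: opens_impl (H k); apply: IH.
  by rewrite FF'.
Qed.

Lemma covers_scongs (label : finType) (N V : eqType) (e : N -> V) (P Q : proc label N) X G :
  scongs P Q -> covers e P X G -> covers e Q X G.
Proof.
move=> PQ; elim: PQ X G => {P Q} [P Q PQ|P|P Q R _ IH1 _ IH2] X G //.
  exact: covers_scong.
by move/IH1/IH2.
Qed.

(** Reflexivity of matching, with accumulators: whatever [P] opens to is a matching for [P] itself,
    added to what [X] and [G] already hold. *)
Lemma opens_covers (label : finType) (V : eqType) (M : Type) (e : M -> V) (P : proc label M)
    (phi : seq V -> seq (proc label V) -> Prop) X G :
  (forall X' G', covers e P X' G' -> phi (X' ++ X) (G' ++ G)) -> opens e P phi X G.
Proof.
have E (A B : Type) (h : A -> B) x : oapp id x \o omap h = oapp h x.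
  by apply: functional_extensionality => -[].
elim: P e phi X G => {M} [M|M x y P IH|M x P IH|M P IHP Q IHQ|M P IH|M x L F IH|M x L F IH]
  e phi X G /= H.
- exact: (H [::] [::]).
- apply: (H [::] [:: _]); eexists; split=> //.
  by rewrite opens_map; apply: IH => X' G'; rewrite !cats0.
- apply: (H [::] [:: _]); eexists; split=> // z.
  by rewrite opens_map E; apply: IH => X' G'; rewrite !cats0.
- apply: IHP => X1 G1 H1; apply: IHQ => X2 G2 H2; rewrite !catA; apply: H.
  exists X1, X2, G1, G2; split=> //; first by rewrite perm_catC.
  exact: Permutation_app_comm.
- move=> x; apply: IH => X' G' H'; rewrite -cat_rcons; apply: H.
  by exists x, X'; rewrite perm_rcons.
- apply: (H [::] [:: _]); eexists; split=> // l.
  by rewrite opens_map; apply: IH => X' G'; rewrite !cats0.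
- apply: (H [::] [:: _]); eexists; split=> // l.
  by rewrite opens_map; apply: IH => X' G'; rewrite !cats0.
Qed.

(** * From matchings to derivations *)

Section Soundness.
Variables (label : finType) (V : choiceType).
Hypothesis V_inf : infinite V.
Local Notation threads := (map (tr (label := label) (@id V))).

(** The par and load rules mirror the clauses of [opens]. A fresh name is chosen at each
    restriction, so opened names stay distinct and the continuation has to be derived only for such
    lists. *)
Lemma opens_sound (M : Type) (e : M -> V) (P : proc label M)
    (phi : seq V -> seq (proc label V) -> Prop) (Delta : seq (form label V)) X G :
  opens e P phi X G -> uniq X ->
  (forall X' G', uniq X' -> phi X' G' -> derivable (new_store X') (Delta ++ threads G')) ->
  derivable (new_store X) (tr e P :: Delta ++ threads G).
Proof.
have thread (T : Type) (d : T -> V) (Q : proc label T) D Y H :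
    derivable (new_store Y) (D ++ threads (map_proc d Q :: H)) ->
    derivable (new_store Y) (tr d Q :: D ++ threads H).
  apply: d_exch; rewrite map_cons tr_map_proc.
  exact: Permutation_sym (Permutation_middle _ _ _).
elim: P e phi Delta X G
  => {M} [M|M x y P IH|M x P IH|M P IHP Q IHQ|M P IH|M x L F IH|M x L F IH]
  e phi Delta X G O uX H; try by apply: thread; apply: H.
(* The unit coming from [Nil] is split off by mix, with the empty store on its side. *)
- have -> : new_store X = (fmap0 + new_store X)%fset by rewrite -(new_store_cat [::]).
  apply: (d_mix (Gamma := [:: FUnit])); [|exact: d_unit|exact: H].
  exact: (@disjoint_new_store _ [::]).
(* The right component waits in the side context while the left one is opened. *)
- rewrite [tr _ _]/=; apply: d_par; apply: (IHP e _ (tr e Q :: Delta) _ _ O) => // X' G' uX' O'.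
  exact: IHQ O' _ H.
- have [x [xX xG]] := fresh_exists X (tr e (PNu P) :: Delta ++ threads G) V_inf.
  apply: (derivable_load (x := x)) => //; first by rewrite mem_new_store.
  rewrite inst_tr; apply: (IH (oapp e x) phi Delta (x :: X)) => //=.
  by rewrite xX.
Qed.

(** A matching for a parallel composition prescribes how the tensor rule splits store and threads;
    distinctness of [X] makes the two stores disjoint. [Delta] follows the left premise. *)
Lemma derivable_tens_threads (A B : form label V) X X1 X2
    (G G1 G2 : seq (proc label V)) (Delta : seq (form label V)) :
  perm_eq X (X1 ++ X2) -> Permutation G (G1 ++ G2) -> uniq X ->
  (uniq X1 -> derivable (new_store X1) (A :: Delta ++ threads G1)) ->
  (uniq X2 -> derivable (new_store X2) (B :: threads G2)) ->
  derivable (new_store X) (FTens A B :: Delta ++ threads G).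
Proof.
move=> XE GE; rewrite (perm_uniq XE) => uX H1 H2.
have /and3P[uX1 _ uX2] : [&& uniq X1, ~~ has [in X1] X2 & uniq X2] by rewrite -cat_uniq.
rewrite (perm_new_store XE) new_store_cat.
apply: (@d_exch _ _ _ (FTens A B :: (Delta ++ threads G1) ++ threads G2)).
  rewrite -catA; apply/perm_skip/Permutation_app_head; rewrite -map_cat.
  exact/Permutation_map/Permutation_sym.
by apply: d_tens; [apply: disjoint_new_store|apply: H1|apply: H2].
Qed.

Lemma derivable_ax_sym (S : store V) x (t : term label V) :
  derivable S [:: FRcv x t; FSnd x t].
Proof. by apply: d_exch (d_ax S x t); apply: perm_swap. Qed.

(** The whole store goes to the premise that matches the prefixes, where an axiom absorbs it;
    continuations restart from the empty store, as in [covers]. *)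
Lemma derivable_seq_nil X (Gamma : seq (form label V)) (A B C D : form label V) :
  derivable (new_store X) [:: A; C] -> derivable (new_store [::]) (B :: D :: Gamma) ->
  derivable (new_store X) (FSeq A B :: FSeq C D :: Gamma).
Proof.
move=> H1 H2; rewrite -(cats0 X) new_store_cat.
apply: (d_seq (Gamma := [::])) => //; rewrite /disjoint_stores fdisjointX0 //.
Qed.

Lemma prefix_sound (M T : Type) (d : M -> V) (e : T -> V) (Q : proc label M)
    (P : proc label T) :
  (forall X G, covers d Q X G -> uniq X ->
    derivable (new_store X) (neg (tr d Q) :: threads G)) ->
  opens e P (covers d Q) [::] [::] ->
  derivable (new_store [::]) [:: neg (tr d Q); tr e P].
Proof.
move=> IH O; apply: (d_exch (perm_swap _ _ _)).
apply: (opens_sound (Delta := [:: neg (tr d Q)]) O) => // X' G' uX' C.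
exact: IH.
Qed.

(** The decomposition phase: each constructor of [Q] dictates the rule for its negation, and the
    matching supplies the popped names, the splittings and the dual threads. *)
Lemma covers_sound (M : Type) (e : M -> V) (Q : proc label M) X G :
  covers e Q X G -> uniq X -> derivable (new_store X) (neg (tr e Q) :: threads G).
Proof.
elim: Q e X G
  => {M} [M|M x y P IH|M x P IH|M P IHP Q IHQ|M P IH|M x L F IH|M x L F IH] e X G.
- by move=> -> _; apply: d_unit.
- case=> P' [-> O] _; apply: derivable_seq_nil; first exact: derivable_ax_sym.
  exact: (prefix_sound (IH _) O).
- case=> P' [-> O] _ /=.
  set A := FSeq _ _; set B := FEx _.
  (* [z] is both the eigenvariable for the negated input and the witness for the existential in the
     thread. *)
  have [z [_ zG]] := fresh_exists [::] [:: FAll A; B] V_inf.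
  apply: (derivable_all zG); apply: (d_exch (perm_swap _ _ _)).
  apply: (derivable_ex V_inf (y := z)); apply: (d_exch (perm_swap _ _ _)).
  rewrite /inst /= -!/(inst _ _) inst_neg_tr inst_tr.
  apply: derivable_seq_nil; first exact: d_ax.
  exact: (prefix_sound (IH _) (O z)).
- case=> X1 [X2 [G1 [G2 [XE GE H1 H2]]]] uX.
  by apply: (derivable_tens_threads (Delta := [::]) XE GE uX) => ?; [apply: IHP|apply: IHQ].
- case=> y [X' [XE H]]; rewrite (perm_uniq XE) (perm_new_store XE) /= => /andP[yX uX].
  apply: (@derivable_pop _ _ V_inf _ _ New); first by rewrite mem_new_store.
  by rewrite inst_neg_tr; apply: IH.
(* Here the thread is the additive conjunction, so it is branched first; the disjunction from the
   negation then follows the label of the branch. *)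
- case=> F' [-> O] _ /=; apply: (d_exch (perm_swap _ _ _)).
  apply: d_with => l; apply: (d_exch (perm_swap _ _ _)); apply: (@d_plus _ _ _ _ _ _ _ l).
  apply: derivable_seq_nil; first exact: derivable_ax_sym.
  exact: (prefix_sound (IH l _) (O l)).
- case=> F' [-> O] _ /=.
  apply: d_with => l; apply: (d_exch (perm_swap _ _ _)); apply: (@d_plus _ _ _ _ _ _ _ l).
  apply: (d_exch (perm_swap _ _ _)).
  apply: derivable_seq_nil; first exact: d_ax.
  exact: (prefix_sound (IH l _) (O l)).
Qed.

Lemma opens_covers_sound (M T : Type) (d : M -> V) (e : T -> V) (Q : proc label M)
    (P : proc label T) :
  opens e P (covers d Q) [::] [::] -> derivable (new_store [::]) [:: neg (tr d Q); tr e P].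
Proof. by apply: prefix_sound => X G; apply: covers_sound. Qed.

Lemma derivable_nu (N : eqType) (e : N -> V) x y (P : proc label N) X
    (Gamma : seq (form label V)) :
  y \notin X ->
  derivable (new_store X) (neg (tr (fun z => if z == x then y else e z) P) :: Gamma) ->
  derivable (new_store (y :: X)) (neg (tr e (p_nu x P)) :: Gamma).
Proof.
move=> yX H; apply: (@derivable_pop _ _ V_inf _ _ New); first by rewrite mem_new_store.
by rewrite inst_neg_tr tr_map_proc oapp_bind.
Qed.

(** * Reduction steps *)

(** A matching for the redex exposes its two dual prefixes as threads. The seq rule consumes both at
    once, and the tensor of the reduct then meets the two continuations. An idle component is
    matched by [covers_sound], and Struc only transports the matching. *)
Lemma step_sound (N : eqType) (e : N -> V) s c (P P' : proc label N) X G :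
  step s c P P' -> c <> CChoice -> covers e P X G -> uniq X ->
  derivable (new_store X) (neg (tr e P') :: threads G).
Proof.
move=> st; elim: st e X G => {s c P P'} //.
- move=> _ x a b P Q e X G _ [X1 [X2 [G1 [G2 [XE GE [P0 [G1E O1]] [Q0 [G2E O2]]]]]]] uX.
  subst G1 G2; apply: d_exch; first exact/perm_skip/Permutation_map/Permutation_sym/GE.
  apply: (d_exch (Permutation_sym (Permutation_rev _))); rewrite /rev /=.
  (* The received name is the one sent, so the two prefixes become dual and the axiom applies. *)
  apply: (derivable_ex V_inf (y := e a)); rewrite /inst /= -/(inst _ _) inst_tr.
  apply: derivable_seq_nil; first exact: derivable_ax_sym.
  apply: (d_exch (Permutation_sym (Permutation_rev _))); rewrite /rev /=.
  rewrite -[fmap0]/(new_store ([::] ++ [::])) new_store_cat.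
  apply: (d_tens (Gamma := [:: tr id P0])); first exact: disjoint_new_store.
    exact: opens_covers_sound.
  apply: opens_covers_sound; apply: opens_impl (O2 (e a)) => X' G' /covers_map H.
  (* Instantiating the bound [b] at [e a] agrees with substituting [a] for [b] before applying
     [e]. *)
  apply/covers_map; apply: covers_ext H => z _ /=.
  by rewrite /bind /repl; case: eqP.
- move=> _ x L k F F' e X G _ [X1 [X2 [G1 [G2 [XE GE [P0 [G1E O1]] [Q0 [G2E O2]]]]]]] uX.
  subst G1 G2; apply: d_exch; first exact/perm_skip/Permutation_map/Permutation_sym/GE.
  apply: (d_exch (Permutation_sym (Permutation_rev _))); rewrite /rev /=.
  apply: (@d_plus _ _ _ _ _ _ _ k); apply: (d_exch (perm_swap _ _ _)).
  apply: d_with => l.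
  (* The selection is already narrowed to one label, so its conjunction has a single branch. *)
  have {l} -> : l = idx1 (val k).
    by apply: val_inj; apply/set1P; case: l.
  apply: derivable_seq_nil; first exact: d_ax.
  apply: (@d_exch _ _ _ [:: neg (tr e (PPar (F (idx1 (val k))) (F' k)));
    tr id (P0 (idx1 (val k))); tr id (Q0 k)]).
    exact: (Permutation_cons_append [:: _; _] _).
  rewrite -(cats0 [::]) new_store_cat.
  apply: (d_tens (Gamma := [:: tr id (P0 _)])); first exact: disjoint_new_store.
    exact: opens_covers_sound.
  exact: opens_covers_sound.
- move=> s c x P P' _ IH e X G cC /covers_nu[y [X' [XE H]]].
  rewrite (perm_uniq XE) (perm_new_store XE) /= => /andP[yX uX].
  by apply: derivable_nu => //; apply: IH.
- move=> s c P P' Q _ IH e X G cC [X1 [X2 [G1 [G2 [XE GE H1 H2]]]]] uX.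
  apply: (derivable_tens_threads (Delta := [::]) XE GE uX) => u; first exact: IH.
  exact: covers_sound.
- by move=> c P P' Q PP' _ _ IH e X G cC H uX; apply: IH => //; apply: covers_scongs H.
Qed.

(* A choice step leaves open which label is selected, so that the rule for the
   additive conjunction must be applied to the selecting thread before the
   context of the step is decomposed; hence that thread is singled out. *)
Lemma choice_sound (N : eqType) s c (P P' : proc label N) :
  step s c P P' -> c = CChoice ->
  exists (L : lset label) (R : idx L -> proc label N),
    [/\ exists l, R l = P', forall l, step s CChoice P (R l)
      & forall (e : N -> V) X G, covers e P X G -> uniq X ->
        exists x (F : idx L -> proc label V) H, Permutation G (PSel x F :: H) /\
          forall l, derivable (new_store X)
            (neg (tr e (R l)) :: FSeq (FSnd x (TLab (val l))) (tr id (F l)) :: threads H)].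
Proof.
elim=> {s c P P'} //.
- move=> s x L F k _; exists L, (fun l => PSel x (fun _ : idx (lset1 (val l)) => F l)).
  split; first by exists k.
    by move=> l; apply: step_choice.
  move=> e X G [F' [-> O]] _; exists (e x), F', [::]; split=> // l.
  apply: (@d_plus _ _ _ _ _ _ _ (idx1 (val l))).
  apply: derivable_seq_nil; first exact: derivable_ax_sym.
  exact: opens_covers_sound.
- move=> s c x P P' _ IH cC; have [L [R [[k RK] RS H]]] := IH cC.
  exists L, (fun l => p_nu x (R l)); split.
    by exists k; rewrite RK.
    by move=> l; apply: step_res.
  move=> e X G /covers_nu[y [X' [XE /H{}H]]].
  rewrite (perm_uniq XE) (perm_new_store XE) /= => /andP[yX /H[z [F [H' [GE D]]]]].
  by exists z, F, H'; split=> // l; apply: derivable_nu.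
- move=> s c P P' Q _ IH cC; have [L [R [[k RK] RS H]]] := IH cC.
  exists L, (fun l => PPar (R l) Q); split.
    by exists k; rewrite RK.
    by move=> l; apply: step_par.
  move=> e X G [X1 [X2 [G1 [G2 [XE GE /H{}H H2]]]]] uX.
  have uX1 : uniq X1 by move: uX; rewrite (perm_uniq XE) cat_uniq => /and3P[].
  have [z [F [H' [GE' D]]]] := H uX1.
  exists z, F, (H' ++ G2); split.
    exact: Permutation_trans GE (Permutation_app_tail _ GE').
  (* The side context [[:: _]] is the chosen branch of the selecting thread; it must go with the
     component that makes the choice. *)
  move=> l; apply: (derivable_tens_threads (Delta := [:: _]) XE (Permutation_refl _) uX) => u.
    exact: D.
  exact: covers_sound.
- move=> c P P' Q PP' neq _ IH cC; have [L [R [[k RK] RS H]]] := IH cC.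
  (* The family of the Struc-free step is kept: all its members are reached from [P] through the
     same precongruence chain. *)
  exists L, R; split; first by exists k.
    by move=> l; apply: step_struc PP' neq (RS l).
  by move=> e X G C; apply: H; apply: covers_scongs C.
Qed.

(** * From matchings to provable implications *)

(** Opening [P] yields matchings for [P] by reflexivity, so only sequents whose threads match [P]
    remain to be derived. *)
Lemma provable_lolli (N : Type) (e : N -> V) (P : proc label N) (A : form label V) :
  (forall X G, covers e P X G -> uniq X -> derivable (new_store X) (neg A :: threads G)) ->
  provable (lolli A (tr e P)).
Proof.
move=> H; rewrite /provable /lolli; apply: d_par; apply: (d_exch (perm_swap _ _ _)).
apply: (@opens_sound _ e P (covers e P) [:: neg A] [::] [::]) => //.
  by apply: opens_covers => X G; rewrite !cats0.
by move=> X G uX C; apply: H.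
Qed.

End Soundness.

Theorem lemma2 (label : finType) (N V : countType) (i : N -> V)
    (i_inj : injective i) (V_inf : infinite V) (P P' : proc label N) :
  (scongs P P' -> provable (lolli (tr i P') (tr i P))) /\
  (forall c : core, step true c P P' ->
     ((c = CCom \/ c = CLabel) /\ provable (lolli (tr i P') (tr i P))) \/
     (c = CChoice /\
      exists (L : lset label) (R : idx L -> proc label N),
        [/\ exists l, R l = P',
            forall l, reduces P (R l)
          & provable (lolli (FWith (idx_gt0 L) (fun l => tr i (R l))) (tr i P))])).
Proof.
split=> [PP'|c st].
  apply: provable_lolli => // X G C; apply: covers_sound => //.
  exact: covers_scongs C.
have [cC|cC] : c = CChoice \/ c <> CChoice by case: c {st}; [right|left|right].
  right; split=> //; have [L [R [RP RS H]]] := choice_sound V_inf st cC.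
  exists L, R; split=> // [l|]; first by exists CChoice; apply: RS.
  apply: provable_lolli => // X G C uX.
  have [x [F [G0 [GE D]]]] := H _ _ _ C uX.
  apply: d_exch; first exact/perm_skip/Permutation_map/Permutation_sym/GE.
  (* The selecting thread is branched first; in branch [l] the negated conjunction, a disjunction,
     is resolved to [R l]. *)
  apply: (d_exch (perm_swap _ _ _)); apply: d_with => l.
  apply: (d_exch (perm_swap _ _ _)); exact: (@d_plus _ _ _ _ _ _ _ l).
left; split; first by case: c cC {st} => // _; [left|right].
by apply: provable_lolli => // X G; apply: step_sound st cC.
Qed.
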